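(* For every integer $d\ge 3$ there is a constant $c_d>0$ depending only on $d$ such that for every integer $k\ge 2$ the following holds with $\varepsilon_{d,k} = 1/k^{c_d}$. Every sufficiently large (in terms of $d$ and $k$) finite point set $P$ in $\mathbb{R}^d$ in general position contains $2k$ subsets $A_1,\ldots,A_k,B_1,\ldots,B_k\subset P$, each of size at least $\varepsilon_{d,k}|P|$, such that every pair of sets $A=\{a_1,\ldots,a_k\}$ and $B=\{b_1,\ldots,b_k\}$ with $a_i\in A_i$ and $b_i\in B_i$ for all $1\le i\le k$ is mutually avoiding.
   Context: A point set in $\mathbb{R}^d$ is in general position if no $d+1$ of its members lie on a common hyperplane. Given two point sets $A$ and $B$ in $\mathbb{R}^d$, $A$ avoids $B$ if no hyperplane generated by a $d$-tuple of (distinct) points of $A$ intersects the convex hull of $B$. The sets $A$ and $B$ are mutually avoiding if $A$ avoids $B$ and $B$ avoids $A$. *)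

(* Defs.v *)
From mathcomp Require Import all_boot all_order all_algebra finmap.
From mathcomp Require Import all_classical all_reals all_analysis.

Set Implicit Arguments.
Unset Strict Implicit.
Unset Printing Implicit Defensive.

Import Order.TTheory GRing.Theory Num.Theory.

Local Open Scope classical_set_scope.
Local Open Scope ring_scope.

Section MutuallyAvoiding.
Variables (R : realType) (d : nat).
Implicit Types (A B H P : set 'rV[R]_d).

Definition is_hyperplane H : Prop :=
  exists (u : 'cV[R]_d) (c : R),
    u != 0 /\ H = [set x | (x *m u) ord0 ord0 = c].

Definition convex_hull A : set 'rV[R]_d :=
  smallest (@convex_set R 'rV[R]_d) A.

Definition affine_hull (n : nat) (t : 'I_n -> 'rV[R]_d) : set 'rV[R]_d :=
  [set x | exists2 w : 'I_n -> R,
             \sum_(i < n) w i = 1 & x = \sum_(i < n) w i *: t i].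

(* An affinely dependent d-tuple generates no hyperplane, since its affine
   hull is then too small. *)
Definition generated_hyperplane (t : 'I_d -> 'rV[R]_d) H : Prop :=
  is_hyperplane H /\ H = affine_hull t.

(* Families of distinct points are encoded as injective functions. *)
Definition general_position P : Prop :=
  forall t : 'I_d.+1 -> 'rV[R]_d, injective t -> (forall i, P (t i)) ->
  forall H, is_hyperplane H -> ~ (forall i, H (t i)).

Definition avoids A B : Prop :=
  forall t : 'I_d -> 'rV[R]_d, injective t -> (forall i, A (t i)) ->
  forall H, generated_hyperplane t H -> H `&` convex_hull B = set0.

Definition mutually_avoiding A B : Prop := avoids A B /\ avoids B A.

End MutuallyAvoiding.

(* Main.v *)
Require Import Defs.
From mathcomp Require Import all_boot all_order all_algebra finmap.
From mathcomp Require Import all_classical all_reals all_analysis.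
From mathcomp Require Import perm zify ring lra.

Import Order.TTheory GRing.Theory Num.Theory.

Set Implicit Arguments.
Unset Strict Implicit.
Unset Printing Implicit Defensive.

(* Work with homogeneous coordinates (1, p) in dimension d + 1, so that the
   orientation of d + 1 points is a determinant.

   Linear functionals cut the space into cells; a nonzero vector is a sum of at
   most 2^d vectors on one-dimensional faces of its closed cell, and each such ray
   is determined by d of the functionals. Hence polynomially many cones, each
   spanned by boundedly many rays, cover the space without being crossed by the
   functionals. If the functionals are a random sample from a finite family, then
   every cone is crossed by only a small fraction of the family.

   Apply this d + 1 times. In round r the family consists of the hyperplanes
   through d points, the first r of them being generators of cones found in
   earlier rounds and the others being points of P. Each round sorts P into
   polynomially many classes. For M random points of P, no hyperplane arising from
   d + 1 of them crosses the cone of the corresponding class, so by multilinearity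
   of the determinant (and general position) replacing each of the M points by any
   member of its class preserves all orientations.

   It remains to select mutually avoiding k-sets among these M points. Take m of
   the points; the hyperplanes that they span leave k of the remaining points in
   one cell, and the hyperplanes spanned by these k points leave k of the m points
   in one cell. Polynomial bounds on the number of cells make m and M polynomial
   in k. *)

(** * Counting *)

Section Counting.
Local Open Scope nat_scope.

Lemma card_sum_pred (T : finType) (A : pred T) : #|A| = \sum_t A t.
Proof.
by rewrite -sum1_card big_mkcond; apply: eq_bigr => t _; rewrite unfold_in; case: (A t).
Qed.

Lemma leq_card_exists (Z T : finType) (A : pred T) (B : Z -> pred T) :
  (forall t, A t -> exists z, B z t) -> #|A| <= \sum_z #|B z|.
Proof.
move=> AB; rewrite card_sum_pred.
under [X in _ <= X]eq_bigr do rewrite card_sum_pred.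
rewrite exchange_big /=; apply: leq_sum => t _.
case At: (A t) => //; have [z Bz] := AB t At.
by rewrite (bigD1 z) //= Bz.
Qed.

Lemma exists_avoiding (Z T : finType) (bad : Z -> pred T) :
  \sum_z #|bad z| < #|T| -> exists t, forall z, ~~ bad z t.
Proof.
move=> lt.
suff: [exists t, [forall z, ~~ bad z t]].
  by move=> /existsP[t /forallP ht]; exists t.
apply: contraLR lt => /existsPn hall; rewrite -leqNgt.
apply: leq_card_exists => t _; have /forallPn[z /negPn bz] := hall t.
by exists z.
Qed.

(** Union bound: fewer than [W] bad events, each of probability at most 1/[W], leave some
    outcome. *)
Lemma exists_avoiding_uniform (Z T : finType) (bad : Z -> pred T) (W : nat) :
  (forall z, #|bad z| * W <= #|T|) -> #|Z| < W -> 0 < #|T| ->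
  exists t, forall z, ~~ bad z t.
Proof.
move=> hbad ltW T0; apply: exists_avoiding.
have : (\sum_z #|bad z|) * W <= #|Z| * #|T|.
  by rewrite big_distrl -sum_nat_const; apply: leq_sum => z _.
by move: (\sum_z _) => n; nia.
Qed.

Section Resampling.
Variables (J I : finType).
Implicit Type q : {ffun J -> I}.

Definition upd q (j : J) (i : I) : {ffun J -> I} :=
  [ffun a => if a == j then i else q a].

Lemma upd_id q j i : upd q j i j = i.
Proof. by rewrite ffunE eqxx. Qed.

Lemma upd_neq q j i a : a != j -> upd q j i a = q a.
Proof. by move=> /negPf ne; rewrite ffunE ne. Qed.

(** Exchanging [q j] with an independent uniform [i] is an involution on pairs. As [F] ignores the
    old value of [q j], testing it at [q j] amounts to testing it at [i]. *)
Lemma card_resample (j : J) (F : {ffun J -> I} -> I -> bool) :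
  (forall q i i', F (upd q j i') i = F q i) ->
  #|I| * #|[pred q | F q (q j)]| = \sum_i #|[pred q | F q i]|.
Proof.
move=> hF; rewrite [X in _ * X]card_sum_pred -sum_nat_const.
under [RHS]eq_bigr do rewrite card_sum_pred.
rewrite !pair_big /=.
pose phi (p : I * {ffun J -> I}) := (p.2 j, upd p.2 j p.1).
have phiK : involutive phi.
  move=> [i q]; rewrite /phi /= upd_id; congr pair; apply/ffunP => a.
  by rewrite !ffunE; case: eqP => // ->.
rewrite (reindex_inj (inv_inj phiK)) /=.
by apply: eq_bigr => -[i q] _ /=; rewrite upd_id hF.
Qed.

Lemma card_resample_le (j : J) (F : {ffun J -> I} -> I -> bool) a b :
  (forall q i i', F (upd q j i') i = F q i) ->
  (forall q, #|[pred i | F q i]| * a <= b) ->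
  #|I| * #|[pred q | F q (q j)]| * a <= #|{ffun J -> I}| * b.
Proof.
move=> hF hab; rewrite (card_resample hF).
rewrite (eq_bigr (fun i => \sum_q F q i)) => [|i _]; last by rewrite card_sum_pred.
rewrite exchange_big /= big_distrl -sum_nat_const /=.
by apply: leq_sum => q _; apply: leq_trans (hab q); rewrite card_sum_pred.
Qed.

End Resampling.

(* Sampling with union bound (Clarkson): an object [l] is determined by at most
   [u] of the [h] samples, and the other samples independently miss its crossing
   set, which is unlikely when this set is large. *)
Lemma exists_sample (Om L : finType) (h u E : nat) (used : L -> {set 'I_h})
    (cr : {ffun 'I_h -> Om} -> L -> {set Om}) :
  (forall l, #|used l| <= u) ->
  (forall (s s' : {ffun 'I_h -> Om}) l,
     (forall a, a \in used l -> s a = s' a) -> cr s l = cr s' l) ->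
  0 < #|Om| -> 0 < E -> u <= h -> #|L| * E.-1 ^ (h - u) < E ^ (h - u) ->
  exists s : {ffun 'I_h -> Om},
    forall l, (forall a, s a \notin cr s l) -> #|cr s l| * E <= #|Om|.
Proof.
move=> card_used cr_local Om0 E0 leuh ltL.
have /card_gt0P[w0 _] := Om0.
pose bad l : pred {ffun 'I_h -> Om} :=
  [pred s : {ffun 'I_h -> Om} |
    [forall a, s a \notin cr s l] && (#|Om| < #|cr s l| * E)].
have cardF : #|{ffun 'I_h -> Om}| = #|Om| ^ h by rewrite card_ffun card_ord.
have key l : #|bad l| * E ^ (h - u) <= #|Om| ^ h * E.-1 ^ (h - u).
  set U := used l; have leU : #|U| <= u := card_used l.
  (* A member [t] of [T] records the values on [U], with default [w0] elsewhere; [Fam t] fixes these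
     values and makes the other samples miss the crossing set. *)
  pose T : pred {ffun 'I_h -> Om} := [in pffun_on w0 U predT].
  pose Fam (t : {ffun 'I_h -> Om}) : pred {ffun 'I_h -> Om} :=
    [in family (fun a => if a \in U then pred1 (t a) else [predC cr t l])].
  pose B t := [pred s : {ffun 'I_h -> Om} | [&& T t, #|Om| < #|cr t l| * E & Fam t s]].
  have le1 : #|bad l| <= \sum_t #|B t|.
    apply: leq_card_exists => s /andP[/forallP sn big].
    pose t := [ffun a => if a \in U then s a else w0].
    have crt : cr t l = cr s l by apply: cr_local => a aU; rewrite ffunE aU.
    exists t; rewrite /= crt big /=; apply/andP; split.
      apply/pffun_onP; split; last by move=> *.
      by apply/supportP => a aU; rewrite ffunE (negPf aU).
    apply/familyP => a; case: ifP => aU; rewrite inE /=.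
      by rewrite ffunE aU.
    by rewrite crt sn.
  have le2 t : #|B t| * E ^ (h - #|U|) <= T t * (#|Om| * E.-1) ^ (h - #|U|).
    case: (boolP (T t && (#|Om| < #|cr t l| * E))) => [/andP[Tt big]|nb]; last first.
      suff -> : #|B t| = 0 by [].
      apply: eq_card0 => s; rewrite !inE /=; apply/and3P => -[Tt big _].
      by rewrite Tt big in nb.
    rewrite Tt mul1n.
    have -> : #|B t| = (#|Om| - #|cr t l|) ^ (h - #|U|).
      have -> : #|B t| =
        #|family (fun a => if a \in U then pred1 (t a) else [predC cr t l])|.
        by apply: eq_card => s; rewrite [LHS]unfold_in /= Tt big.
      rewrite card_family foldrE big_map big_enum /=.
      rewrite (bigID (mem U)) /= big1 ?mul1n => [|a aU]; last first.
        by rewrite aU card1.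
      rewrite (eq_bigr (fun=> #|Om| - #|cr t l|)) => [|a aU]; last first.
        by rewrite (negPf aU) -(cardC (cr t l)) addKn.
      rewrite prod_nat_const; congr (_ ^ _).
      by rewrite -[h in h - _]card_ord -(cardC U) addKn.
    (* Each sample outside [U] is confined to the complement of a large crossing set, a fraction of
       at most ([E] - 1)/[E] of [Om]. *)
    case: (h - #|U|) => // v; rewrite -expnMn leq_exp2r //.
    have : #|cr t l| <= #|Om| by exact: max_card.
    by rewrite mulnBl; nia.
  have le3 : #|bad l| * E ^ (h - #|U|) <= #|Om| ^ h * E.-1 ^ (h - #|U|).
    apply: leq_trans (leq_mul le1 (leqnn _)) _; rewrite big_distrl /=.
    apply: (@leq_trans (\sum_t T t * (#|Om| * E.-1) ^ (h - #|U|))).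
      by apply: leq_sum => t _; apply: le2.
    rewrite -big_distrl /= -card_sum_pred.
    have -> : #|T| = #|Om| ^ #|U| by rewrite -(card_pffun_on w0 U predT).
    rewrite expnMn mulnA -expnD subnKC //.
    by apply: leq_trans leU leuh.
  have E1 : E.-1 ^ (u - #|U|) <= E ^ (u - #|U|).
    by case: (u - #|U|) => // v; rewrite leq_exp2r // leq_pred.
  have E2 : 0 < E ^ (u - #|U|) by rewrite expn_gt0 E0.
  have dec : h - #|U| = (h - u) + (u - #|U|) by lia.
  rewrite -(leq_pmul2r E2) -mulnA -expnD -dec.
  apply: leq_trans le3 _; rewrite dec expnD mulnA leq_mul2l.
  by rewrite E1 orbT.
have [s hs] : exists s, forall l, ~~ bad l s.
  apply: exists_avoiding; have E2 : 0 < E ^ (h - u) by rewrite expn_gt0 E0.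
  rewrite -(ltn_pmul2r E2) big_distrl /= cardF.
  apply: (@leq_ltn_trans (\sum_(l : L) #|Om| ^ h * E.-1 ^ (h - u))).
    by apply: leq_sum => l _; apply: key.
  rewrite sum_nat_const mulnCA ltn_pmul2l //; by rewrite expn_gt0 Om0.
exists s => l sn; have := hs l; rewrite /= negb_and -leqNgt.
by move=> /orP[/negP[]|//]; apply/forallP.
Qed.

End Counting.

Local Open Scope ring_scope.

(** * Rays of hyperplane arrangements *)

Section Cones.
Variables (R : realFieldType) (d : nat).
Local Notation D := d.+1.
Implicit Types (x y z : 'rV[R]_D) (u : 'cV[R]_D).

Definition ev x u : R := (x *m u) 0 0.

Lemma evD x y u : ev (x + y) u = ev x u + ev y u.
Proof. by rewrite /ev mulmxDl mxE. Qed.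

Lemma evZ a x u : ev (a *: x) u = a * ev x u.
Proof. by rewrite /ev -scalemxAl mxE. Qed.

Lemma evN x u : ev (- x) u = - ev x u.
Proof. by rewrite -scaleN1r evZ mulN1r. Qed.

Lemma ev0 u : ev 0 u = 0.
Proof. by rewrite /ev mul0mx mxE. Qed.

Lemma ev_sum (I : finType) (f : I -> 'rV[R]_D) u :
  ev (\sum_i f i) u = \sum_i ev (f i) u.
Proof. by rewrite /ev mulmx_suml summxE. Qed.

Definition crosses (T : finType) (V : T -> 'rV[R]_D) u : bool :=
  [exists b, exists b', (ev (V b) u < 0) && (0 < ev (V b') u)].

Definition in_cone (T : finType) (V : T -> 'rV[R]_D) x : Prop :=
  exists2 c : T -> R, (forall b, 0 <= c b) & x = \sum_b c b *: V b.

Lemma in_cone_ge0 (T : finType) (V : T -> 'rV[R]_D) x u :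
  in_cone V x -> (forall b, 0 <= ev (V b) u) -> 0 <= ev x u.
Proof.
move=> [c c0 ->] V0; rewrite ev_sum; apply: sumr_ge0 => b _.
by rewrite evZ mulr_ge0.
Qed.

(** Without crossing, one negative generator would make all generators nonpositive, hence [x]
    too. *)
Lemma uncrossed_ge0 (T : finType) (V : T -> 'rV[R]_D) x u :
  in_cone V x -> ~~ crosses V u -> 0 < ev x u -> forall b, 0 <= ev (V b) u.
Proof.
move=> Vx /existsPn nc x0 b; rewrite leNgt; apply/negP => b0.
have /existsPn nb := nc b.
have : 0 <= ev x (- u).
  apply: in_cone_ge0 Vx _ => b'; rewrite /ev mulmxN mxE oppr_ge0 leNgt.
  by have := nb b'; rewrite b0.
by rewrite /ev mulmxN mxE oppr_ge0 leNgt x0.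
Qed.

(* [x] and [z] lie in a common closed cell of the arrangement, [z] possibly on
   the boundary of the cell of [x]. *)
Definition in_cell N (g : 'I_N -> 'cV[R]_D) x z : Prop :=
  forall j, (0 <= ev x (g j) -> 0 <= ev z (g j)) /\
            (ev x (g j) <= 0 -> ev z (g j) <= 0).

(** Rows of the functionals not vanishing at [x] are zeroed to keep the size fixed. The rank is the
    codimension of the face of the arrangement with [x] in its relative interior. *)
Definition tight N (g : 'I_N -> 'cV[R]_D) x : 'M[R]_(N, D) :=
  \matrix_(j, i) (if ev x (g j) == 0 then g j i 0 else 0).

Definition spanning N (g : 'I_N -> 'cV[R]_D) : Prop :=
  forall z, (forall j, ev z (g j) = 0) -> z = 0.

Section Rays.
Variables (N : nat) (g : 'I_N -> 'cV[R]_D).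

Lemma in_cell_trans x y z : in_cell g x y -> in_cell g y z -> in_cell g x z.
Proof.
move=> xy yz j; have [a b] := xy j; have [a' b'] := yz j.
by split=> [/a/a'|/b/b'].
Qed.

Lemma in_cellZ a x z : 0 < a -> in_cell g x z -> in_cell g x (a *: z).
Proof.
by move=> a0 xz j; have [h1 h2] := xz j; rewrite evZ pmulr_rge0 ?pmulr_rle0.
Qed.

Lemma tight_mulE x y j :
  (tight g x *m y^T) j 0 = if ev x (g j) == 0 then ev y (g j) else 0.
Proof.
rewrite mxE; case: ifP => xj.
  rewrite /ev mxE; apply: eq_bigr => i _; by rewrite !mxE xj mulrC.
by apply: big1 => i _; rewrite !mxE xj mul0r.
Qed.

Lemma tight_ker x y :
  (forall j, ev x (g j) = 0 -> ev y (g j) = 0) <-> tight g x *m y^T = 0.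
Proof.
split=> [h|/matrixP h j xj].
  apply/matrixP => j i; rewrite ord1 tight_mulE mxE.
  by case: eqP => // /h.
by have := h j 0; rewrite tight_mulE xj eqxx mxE.
Qed.

(** What is tight at [x] stays tight at [z], and [g j] is new: [y] kills the functionals tight at
    [x] but not [g j], so [g j] is outside their span. *)
Lemma tight_rank_lt x y z j :
  in_cell g x z -> tight g x *m y^T = 0 -> ev z (g j) = 0 -> ev y (g j) != 0 ->
  (\rank (tight g x) < \rank (tight g z))%N.
Proof.
move=> xz xy zj yj.
have sub : (tight g x <= tight g z)%MS.
  apply/row_subP => i; case: (eqVneq (ev x (g i)) 0) => xi.
    have [h1 h2] := xz i.
    have zi : ev z (g i) = 0 by apply/eqP; rewrite eq_le h1 ?h2 ?xi.
    suff -> : row i (tight g x) = row i (tight g z) by apply: row_sub.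
    by apply/rowP => k; rewrite !mxE xi zi !eqxx.
  suff -> : row i (tight g x) = 0 by apply: sub0mx.
  by apply/rowP => k; rewrite !mxE (negPf xi).
rewrite ltn_neqAle mxrankS // andbT; apply: contra yj => /eqP rk.
have : (tight g z <= tight g x)%MS by rewrite -(geq_leqif (mxrank_leqif_sup sub)) rk.
case/submxP => E zE.
have : tight g z *m y^T = 0 by rewrite zE -mulmxA xy mulmx0.
by move=> /tight_ker ->.
Qed.

Lemma rank_tight x : x != 0 -> (\rank (tight g x) <= d)%N.
Proof.
move=> x0; rewrite -ltnS ltn_neqAle rank_leq_col andbT.
apply: contra x0 => full.
have xx : tight g x *m x^T = 0 by apply/tight_ker.
have := row_full_inj full (etrans xx (esym (mulmx0 _ _))).
by move/(congr1 trmx); rewrite trmxK trmx0 => ->.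
Qed.

(** Follow the ray from [x] in direction [y], along which tight functionals stay zero, until another
    functional first vanishes. *)
Lemma move_to_wall x y j0 : tight g x *m y^T = 0 ->
  Num.sg (ev x (g j0)) * ev y (g j0) < 0 ->
  exists2 t : R, 0 < t & in_cell g x (x + t *: y) /\
    (\rank (tight g x) < \rank (tight g (x + t *: y)))%N.
Proof.
move=> xy neg0.
(* [P j] says that [g j] approaches zero along the ray; [T j] is then the time at which it
   vanishes. *)
pose P j := Num.sg (ev x (g j)) * ev y (g j) < 0.
pose T j := `|ev x (g j)| / - (Num.sg (ev x (g j)) * ev y (g j)).
have Tpos j : P j -> 0 < T j.
  move=> Pj; rewrite divr_gt0 ?oppr_gt0 // normr_gt0.
  by apply: contraTneq Pj => xj; rewrite /P xj sgr0 mul0r ltxx.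
case: (@arg_minP _ _ _ j0 P T neg0) => j Pj jmin.
exists (T j); first exact: Tpos.
have cell : in_cell g x (x + T j *: y).
  move=> i; rewrite evD evZ.
  have [xi|xi|xi] := ltrgt0P (ev x (g i)).
  - split => // _; case: (ltP (ev y (g i)) 0) => yi; last first.
      by have := Tpos _ Pj; nra.
    have Pi : P i by rewrite /P gtr0_sg // mul1r.
    have := jmin i Pi; rewrite {2}/T gtr0_sg // mul1r gtr0_norm //.
    rewrite ler_pdivlMr ?oppr_gt0 // mulrN lerNl; lra.
  - split => // _; case: (leP (ev y (g i)) 0) => yi.
      by have := Tpos _ Pj; nra.
    have Pi : P i by rewrite /P ltr0_sg // mulN1r oppr_lt0.
    have := jmin i Pi; rewrite {2}/T ltr0_sg // mulN1r opprK ltr0_norm //.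
    rewrite ler_pdivlMr //; lra.
  - have yi : ev y (g i) = 0 by apply: (tight_ker x y).2.
    by rewrite xi yi mulr0 addr0 lexx.
split=> //; apply: (@tight_rank_lt x y _ j) => //; last first.
  by apply: contraTneq Pj => yj; rewrite /P yj mulr0 ltxx.
rewrite evD evZ /T; have := Pj; rewrite /P.
have [xj|xj|xj] := ltrgt0P (ev x (g j)).
- rewrite gtr0_sg // mul1r => yj.
  by rewrite invrN mulrN mulNr divfK ?subrr // lt_eqF.
- rewrite ltr0_sg // mulN1r opprK oppr_lt0 => yj.
  by rewrite divfK ?subrr // gt_eqF.
- by rewrite xj sgr0 mul0r ltxx.
Qed.

Hypothesis gspan : spanning g.

(** The face of [x] has dimension at least two, so it contains a line segment through [x] along
    which [gs] is constant; the ends where it hits walls, suitably scaled, are the two summands. *)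
Lemma split_cell x : x != 0 -> (\rank (tight g x) < d)%N ->
  exists z1 z2, [/\ x = z1 + z2, z1 != 0 /\ z2 != 0, in_cell g x z1, in_cell g x z2
    & (\rank (tight g x) < \rank (tight g z1))%N /\
      (\rank (tight g x) < \rank (tight g z2))%N].
Proof.
move=> x0 rk.
(* [gs] is positive on the cell of [x] minus the origin, so that both rays from
   [x] inside a level set of [gs] leave the cell. *)
pose gs := \sum_j Num.sg (ev x (g j)) *: g j.
have evgs z : ev z gs = \sum_j Num.sg (ev x (g j)) * ev z (g j).
  rewrite /ev mulmx_sumr summxE; apply: eq_bigr => j _.
  by rewrite -scalemxAr mxE.
have gsx : 0 < ev x gs.
  rewrite lt_neqAle evgs sumr_ge0 ?andbT; last by move=> j _; rewrite -normrEsg.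
  rewrite eq_sym psumr_neq0; last by move=> j _; rewrite -normrEsg.
  apply/hasP; case: (pickP (fun j => ev x (g j) != 0)) => [j xj|h].
    by exists j; rewrite ?mem_index_enum //= -normrEsg normr_gt0.
  case/eqP: x0; apply: gspan => j; apply/eqP.
  by have := h j => /negbFE.
(* Staying in the span of the face and in the level set imposes at most [d] independent conditions
   on [y]. *)
pose A := row_mx (tight g x)^T gs.
have rkA : (\rank A < D)%N.
  rewrite /A -mxrank_tr tr_row_mx trmxK -addsmxE ltnS.
  apply: leq_trans (mxrank_adds_leqif _ _).1 _.
  apply: leq_trans (leq_add (leqnn _) (rank_leq_row gs^T)) _.
  by rewrite addn1.
have : kermx A != 0 by rewrite kermx_eq0 /row_free ltn_eqF.
set y := nz_row (kermx A); rewrite -nz_row_eq0 -/y => y0.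
have /sub_kermxP : (y <= kermx A)%MS by apply: nz_row_sub.
rewrite /A mul_mx_row -[0]row_mx0 => /eq_row_mx[yt ygs].
have xy : tight g x *m y^T = 0 by rewrite -[tight g x]trmxK -trmx_mul yt trmx0.
have {}ygs : ev y gs = 0 by rewrite /ev ygs mxE.
have nz z : ev z gs != 0 -> z != 0.
  by apply: contraNneq => ->; rewrite ev0.
pose F j := Num.sg (ev x (g j)) * ev y (g j).
(* [F] has zero sum and, by [gspan], is not identically zero. Hence it takes both signs, and walls
   lie ahead in both directions [y] and -[y]. *)
have sumF : \sum_j F j = 0 by rewrite -evgs.
have [j0 Fj0] : exists j, F j != 0.
  apply/existsP; apply: contraR y0 => /existsPn F0; apply/eqP/gspan => j.
  have /negPn := F0 j; rewrite mulf_eq0 sgr_eq0 => /orP[/eqP xj|/eqP//].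
  by have /tight_ker := xy; apply.
have [jm Fjm] : exists j, F j < 0.
  apply/existsP; apply: contraR Fj0 => /existsPn F0.
  have F0' j : 0 <= F j by rewrite leNgt F0.
  by have /eqP := sumF; rewrite psumr_eq0 // => /allP/(_ j0); apply; rewrite mem_index_enum.
have [jp Fjp] : exists j, 0 < F j.
  apply/existsP; apply: contraR Fj0 => /existsPn F0.
  have F0' j : 0 <= - F j by rewrite oppr_ge0 leNgt F0.
  have : \sum_j - F j == 0 by rewrite sumrN sumF oppr0.
  rewrite psumr_eq0 // => /allP/(_ j0); rewrite oppr_eq0; apply; by rewrite mem_index_enum.
have [t t0 [tc tr]] := move_to_wall xy Fjm.
have xNy : tight g x *m (- y)^T = 0 by rewrite linearN mulmxN xy oppr0.
have [|s s0 [sc sr]] := @move_to_wall x (- y) jp xNy.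
  by rewrite evN mulrN oppr_lt0.
have ts : 0 < t + s by rewrite addr_gt0.
(* These weights add up to 1 and cancel the contributions of [y]. *)
exists ((s / (t + s)) *: (x + t *: y)), ((t / (t + s)) *: (x + s *: - y)).
have tightZ a z : a != 0 -> \rank (tight g (a *: z)) = \rank (tight g z).
  move=> a0; congr (\rank _); apply/matrixP => j i.
  by rewrite !mxE evZ mulf_eq0 (negPf a0).
have c1 : 0 < s / (t + s) by rewrite divr_gt0.
have c2 : 0 < t / (t + s) by rewrite divr_gt0.
split; rewrite ?tightZ ?gt_eqF //; try exact: in_cellZ.
- rewrite !scalerDr addrACA -scalerDl -mulrDl [s + t]addrC divff ?gt_eqF //.
  rewrite scale1r !scalerA scalerN -scalerBl; set e := (X in X *: y).
  have -> : e = 0 by rewrite /e; field; rewrite gt_eqF.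
  by rewrite scale0r addr0.
- split; apply: nz.
    by rewrite evZ evD evZ ygs mulr0 addr0 mulf_neq0 ?gt_eqF.
  by rewrite evZ evD evZ evN ygs oppr0 mulr0 addr0 mulf_neq0 ?gt_eqF.
Qed.

(** The dimension of the face of [x] is at most [r] + 1, and each split lowers it for both
    summands. *)
Lemma cell_decomposition r x : x != 0 -> (d <= \rank (tight g x) + r)%N ->
  exists V : 'I_(2 ^ r) -> 'rV[R]_D, x = \sum_b V b /\
    forall b, [/\ V b != 0, in_cell g x (V b) & \rank (tight g (V b)) = d].
Proof.
elim: r x => [|r IH] x x0 rk.
  exists (fun=> x); split; first by rewrite big_ord1.
  move=> _; split=> //; apply/eqP.
  by rewrite eqn_leq rank_tight //=; lia.
have [z1 [z2 [xE [z10 z20] xz1 xz2 [rk1 rk2]]]] : exists z1 z2,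
    [/\ x = z1 + z2, z1 != 0 /\ z2 != 0, in_cell g x z1, in_cell g x z2
    & (d <= \rank (tight g z1) + r)%N /\ (d <= \rank (tight g z2) + r)%N].
  (* If [x] is on a one-dimensional face already, it is halved, which keeps the number of summands
     exactly a power of two. *)
  have := rank_tight x0; rewrite leq_eqVlt => /orP[/eqP rkx|ltx].
    exists (2^-1 *: x), (2^-1 *: x).
    have h0 : 0 < 2^-1 :> R by rewrite invr_gt0.
    have hx : 2^-1 *: x != 0 by rewrite scaler_eq0 negb_or gt_eqF.
    have rkh : \rank (tight g (2^-1 *: x)) = d.
      rewrite -[RHS]rkx; congr (\rank _); apply/matrixP => j i.
      by rewrite !mxE evZ mulf_eq0 gt_eqF.
    split=> //; try (by apply: in_cellZ); last by rewrite rkh leq_addr.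
    by rewrite -scalerDl -mulr2n -(mulr_natr 2^-1) mulVf ?scale1r ?pnatr_eq0.
  have [z1 [z2 [xE [z10 z20] xz1 xz2 [rk1 rk2]]]] := split_cell x0 ltx.
  by exists z1, z2; split=> //; split; lia.
have [V1 [E1 P1]] := IH z1 z10 rk1; have [V2 [E2 P2]] := IH z2 z20 rk2.
have e : (2 ^ r.+1 = 2 ^ r + 2 ^ r)%N by rewrite expnS mul2n addnn.
exists (fun b => match fintype.split (cast_ord e b) with inl b1 => V1 b1 | inr b2 => V2 b2 end).
split.
  rewrite xE E1 E2 (reindex (cast_ord (esym e))) /=; last first.
    exists (cast_ord e) => b _; by rewrite ?cast_ordK ?cast_ordKV.
  rewrite big_split_ord /=; congr (_ + _); apply: eq_bigr => b _;
    rewrite cast_ordKV.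
    by rewrite (unsplitK (inl b)).
  by rewrite (unsplitK (inr b)).
move=> b; case: (fintype.split _) => b'.
  by have [? /(in_cell_trans xz1) ? ?] := P1 b'.
by have [? /(in_cell_trans xz2) ? ?] := P2 b'.
Qed.

End Rays.

(** A name for a cone that does not mention the functionals: each of its generators is given by a
    sign and by the indices of [d] functionals vanishing on it. For fixed [d] the number of names is
    polynomial in [N]. *)
Definition label N : finType := {ffun 'I_(2 ^ d) -> bool * {ffun 'I_d -> 'I_N}}.

(* One of the two generators of the intersection of [d] hyperplanes, provided
   that it is a line. *)
Definition ray N (g : 'I_N -> 'cV[R]_D) (p : bool * {ffun 'I_d -> 'I_N}) : 'rV[R]_D :=
  (-1) ^+ p.1 *: nz_row (kermx (\matrix_(i < D, j < d) g (p.2 j) i 0)).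

Definition rays N (g : 'I_N -> 'cV[R]_D) (l : label N) b := ray g (l b).

Lemma ray_local N (g g' : 'I_N -> 'cV[R]_D)
    (p : bool * {ffun 'I_d -> 'I_N}) :
  (forall m, g (p.2 m) = g' (p.2 m)) -> ray g p = ray g' p.
Proof.
move=> gg'; rewrite /ray; congr (_ *: nz_row (kermx _)).
by apply/matrixP => i j; rewrite !mxE gg'.
Qed.

(** Among the tight functionals there are [d] independent ones; their common kernel is the line
    through [z]. *)
Lemma tight_ray N (g : 'I_N -> 'cV[R]_D) z : z != 0 -> \rank (tight g z) = d ->
  exists p, exists2 c : R, 0 < c & z = c *: ray g p.
Proof.
move=> z0 rk.
pose J : {ffun 'I_d -> 'I_N} :=
  [ffun m => maxrankfun (tight g z) (cast_ord (esym rk) m)].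
(* A functional that is not tight has a zero row, which cannot occur among independent rows. *)
have tightJ m : ev z (g (J m)) = 0.
  apply/eqP; rewrite ffunE; set m' := cast_ord _ m.
  apply: contraT => nz; have := maxrowsub_free (tight g z).
  move/row_free_inj => /(_ 1 (delta_mx 0 m') 0).
  rewrite mul0mx -rowE => h; have : row m' (rowsub (maxrankfun (tight g z)) (tight g z)) = 0.
    by apply/rowP => i; rewrite !mxE (negPf nz).
  move/h => /matrixP/(_ 0 m')/eqP; by rewrite !mxE !eqxx oner_eq0.
pose M := \matrix_(i < D, j < d) g (J j) i 0.
have ME : M^T = rowsub (cast_ord (esym rk)) (rowsub (maxrankfun (tight g z)) (tight g z)).
  apply/matrixP => j i; rewrite !mxE; have := tightJ j; rewrite ffunE => ->.
  by rewrite eqxx.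
have rkM : \rank M = d.
  by rewrite -mxrank_tr ME rowsub_cast eqmx_cast eq_maxrowsub.
have zM : (z <= kermx M)%MS.
  apply/sub_kermxP/rowP => j; rewrite [RHS]mxE -[RHS](tightJ j) /ev !mxE.
  by apply: eq_bigr => i _; rewrite mxE.
set w := nz_row (kermx M).
have w0 : w != 0.
  by rewrite /w nz_row_eq0 kermx_eq0 /row_free rkM ltn_eqF.
have : (kermx M <= w)%MS.
  rewrite -(geq_leqif (mxrank_leqif_sup (nz_row_sub (kermx M)))) -/w.
  by rewrite mxrank_ker rkM rank_rV w0 subSnn.
move/(submx_trans zM)/sub_rVP => [a za].
have a0 : a != 0 by apply: contraNneq z0 => a0; rewrite za a0 scale0r.
exists (a < 0, J), `|a|; first by rewrite normr_gt0.
rewrite za /ray /= scalerA; congr (_ *: _).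
by case: (ltrgt0P a) a0 => // _ _; rewrite ?mulr1 // expr1 mulrN1 opprK.
Qed.

(** The generators lie in the closed cell of [x], where no functional takes both strict signs. *)
Lemma exists_label N (g : 'I_N -> 'cV[R]_D) x : spanning g -> x != 0 ->
  exists l : label N, in_cone (rays g l) x /\ forall j, ~~ crosses (rays g l) (g j).
Proof.
move=> gs x0; have [|V [xE VP]] := @cell_decomposition _ _ gs d x x0.
  by rewrite leq_addl.
have /fin_all_exists[l0 /fin_all_exists2[c c0 VE]] :
    forall b, exists p, exists2 c : R, 0 < c & V b = c *: ray g p.
  by move=> b; have [V0 _ rk] := VP b; apply: tight_ray.
pose l : label N := [ffun b => l0 b].
exists l; split.
  exists c => [b|]; first exact: ltW.
  by rewrite xE; apply: eq_bigr => b _; rewrite VE /rays ffunE.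
move=> j; apply/existsPn => b; apply/existsPn => b'; apply/negP => /andP[].
have evl b1 : ev (rays g l b1) (g j) = (c b1)^-1 * ev (V b1) (g j).
  by rewrite VE evZ mulKf ?gt_eqF // /rays ffunE.
rewrite !evl pmulr_rlt0 ?invr_gt0 // pmulr_rgt0 ?invr_gt0 //.
have [_ /(_ j)[h1 _] _] := VP b; have [_ /(_ j)[_ h2] _] := VP b'.
case: (lerP 0 (ev x (g j))) => [/h1|/ltW/h2]; first by move=> /le_gtF ->.
by move=> /le_gtF ->.
Qed.

Lemma same_label_sign (T : finType) (V : T -> 'rV[R]_D) x x' u :
  in_cone V x -> in_cone V x' -> ~~ crosses V u -> ev x u != 0 -> ev x' u != 0 ->
  0 < ev x u * ev x' u.
Proof.
move=> Vx Vx' nc x0 x'0.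
have pos y y' v : in_cone V y -> in_cone V y' -> ~~ crosses V v -> 0 < ev y v ->
    ev y' v != 0 -> 0 < ev y' v.
  move=> Vy Vy' ncv y0 y'0; rewrite lt_neqAle eq_sym y'0.
  exact: in_cone_ge0 Vy' (uncrossed_ge0 Vy ncv y0).
have [xp|xn|xz] := ltrgt0P (ev x u).
- by rewrite mulr_gt0 // (pos _ _ _ Vx Vx').
- have evNu y : ev y (- u) = - ev y u by rewrite /ev mulmxN mxE.
  have : 0 < ev x' (- u).
    apply: (pos _ _ _ Vx Vx'); rewrite ?evNu ?oppr_eq0 ?oppr_gt0 //.
    apply: contra nc => /existsP[b /existsP[b' /andP[]]].
    rewrite !evNu oppr_lt0 oppr_gt0 => h1 h2.
    by apply/existsP; exists b'; apply/existsP; exists b; rewrite h1 h2.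
  by rewrite evNu oppr_gt0 => x'n; rewrite nmulr_rgt0.
- by rewrite xz eqxx in x0.
Qed.

End Cones.

(** * Cuttings from random samples *)

Section Cutting.
Variables (R : realFieldType) (d : nat).
Local Notation D := d.+1.

Lemma card_label N : #|label d N| = ((2 * N ^ d) ^ 2 ^ d)%N.
Proof. by rewrite card_ffun card_prod card_bool card_ffun !card_ord. Qed.

(* The coordinate functionals make all cells pointed cones. *)
Definition with_coords h (f : 'I_h -> 'cV[R]_D) (j : 'I_(h + D)) : 'cV[R]_D :=
  match fintype.split j with inl a => f a | inr i => delta_mx i 0 end.

Lemma with_coords_lshift h (f : 'I_h -> 'cV[R]_D) a : with_coords f (lshift D a) = f a.
Proof. by rewrite /with_coords (unsplitK (inl a)). Qed.

Lemma with_coords_spanning h (f : 'I_h -> 'cV[R]_D) : spanning (with_coords f).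
Proof.
move=> z z0; apply/rowP => i; have := z0 (rshift h i).
by rewrite /with_coords (unsplitK (inr i)) /ev -colE !mxE.
Qed.

(** [exists_sample] applies to labels because a cone is determined by the at most [u] sampled
    functionals named in its label; the coordinate functionals are not random. *)
Lemma cutting (Om I : finType) (f : Om -> 'cV[R]_D) (x : I -> 'rV[R]_D) (E h : nat) :
  let u := (2 ^ d * d)%N in
  (0 < #|Om|)%N -> (0 < E)%N -> (u <= h)%N ->
  (#|label d (h + D)| * E.-1 ^ (h - u) < E ^ (h - u))%N -> (forall i, x i != 0) ->
  exists (cls : I -> label d (h + D))
         (V : label d (h + D) -> 'I_(2 ^ d) -> 'rV[R]_D),
    forall i, in_cone (V (cls i)) (x i) /\
      (#|[set w | crosses (V (cls i)) (f w)]| * E <= #|Om|)%N.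
Proof.
move=> u Om0 E0 leuh ltL x0.
pose g (s : {ffun 'I_h -> Om}) := with_coords (f \o s).
pose used (l : label d (h + D)) :=
  [set a : 'I_h | [exists b, exists m, (l b).2 m == lshift D a]].
pose cr s l := [set w | crosses (rays (g s) l) (f w)].
have [|s s' l ss'|s sP] := @exists_sample Om _ h u E used cr _ _ Om0 E0 leuh ltL.
- move=> l; rewrite -(card_imset (used l) (@lshift_inj h D)).
  pose im := [set (l p.1).2 p.2 | p in [set: 'I_(2 ^ d) * 'I_d]].
  apply: (@leq_trans #|im|).
    apply/subset_leq_card/fintype.subsetP => j /imsetP[a]; rewrite inE.
    move=> /existsP[b /existsP[m /eqP e]] ->.
    by apply/imsetP; exists (b, m); rewrite ?inE.
  apply: leq_trans (leq_imset_card _ _) _.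
  by rewrite cardsT card_prod !card_ord.
- have e b : rays (g s) l b = rays (g s') l b.
    apply: ray_local => m; rewrite /g /with_coords.
    case: (split_ordP ((l b).2 m)) => a ea; last by [].
    rewrite /= ss' // inE; apply/existsP; exists b; apply/existsP; exists m.
    by rewrite ea.
  by apply/setP => w; rewrite !inE /crosses; under eq_existsb do under eq_existsb do rewrite !e.
have /fin_all_exists[cls clsP] :
    forall i, exists l, in_cone (rays (g s) l) (x i) /\
      forall j, ~~ crosses (rays (g s) l) (g s j).
  by move=> i; apply: exists_label => //; apply: with_coords_spanning.
exists cls, (rays (g s)) => i; have [xi ui] := clsP i; split => //.
apply: sP => a; rewrite inE.
by have := ui (lshift D a); rewrite /g with_coords_lshift.
Qed.

End Cutting.

(** * Orientations as determinants *)

Section Det.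
Variables (R : realFieldType) (d : nat).
Local Notation D := d.+1.
Implicit Types (z : 'I_D -> 'rV[R]_D).

Definition rowsdet z : R := \det (\matrix_i z i).

(** Laplace expansion along row [r], as a functional of that row; it depends on the other rows
    only. *)
Definition cof z (r : 'I_D) : 'cV[R]_D := \col_j cofactor (\matrix_i z i) r j.

Lemma cof_eq z z' r : (forall i, i != r -> z i = z' i) -> cof z r = cof z' r.
Proof.
move=> zz'; apply/colP => j; rewrite !mxE /cofactor; congr (_ * \det _).
apply/matrixP => i k; rewrite !mxE zz' //.
by rewrite eq_sym neq_lift.
Qed.

Lemma rowsdetE z r : rowsdet z = ev (z r) (cof z r).
Proof.
rewrite /rowsdet (expand_det_row _ r) /ev mxE.
by apply: eq_bigr => j _; rewrite !mxE.
Qed.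

Lemma eq_rowsdet z z' : z =1 z' -> rowsdet z = rowsdet z'.
Proof. by move=> zz'; congr (\det _); apply/matrixP => i j; rewrite !mxE zz'. Qed.

Lemma rowsdet_ev z (u : 'cV[R]_D) : u != 0 ->
  (forall i, ev (z i) u = 0) -> rowsdet z = 0.
Proof.
move=> u0 zu; apply/eqP; rewrite /rowsdet -det_tr; apply/det0P.
exists u^T; first by rewrite -trmx0 (inj_eq trmx_inj).
rewrite -trmx_mul; apply/matrixP => i j; rewrite !mxE -[RHS](zu j) /ev mxE.
by apply: eq_bigr => k _; rewrite !mxE ord1.
Qed.

Lemma rowsdet_tperm z a b : a != b -> rowsdet (z \o tperm a b) = - rowsdet z.
Proof.
move=> ab; rewrite /rowsdet.
have -> : \matrix_i (z \o tperm a b) i = row_perm (tperm a b) (\matrix_i z i).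
  by apply/matrixP => i j; rewrite !mxE.
by rewrite row_permE det_mulmx det_perm odd_tperm ab expr1 mulN1r.
Qed.

End Det.

(** * Homogeneous classes *)

Section Homogeneous.
Variables (R : realFieldType) (d : nat).
Local Notation D := d.+1.
Local Notation B := (2 ^ d)%N.
Variables (I : finType) (x : I -> 'rV[R]_D).
Hypothesis gp : forall t : 'I_D -> I, injective t -> rowsdet (x \o t) != 0.
Hypothesis x_neq0 : forall i, x i != 0.

(* [W j i] lists the generators of the cone found for the point [i] in round [j]. *)
Definition mixed (r : nat) (W : nat -> I -> 'I_B -> 'rV[R]_D) (p : 'I_D -> I)
    (be : {ffun 'I_D -> 'I_B}) : 'I_D -> 'rV[R]_D :=
  fun j => if (j < r)%N then W j (p j) (be j) else x (p j).

(** If [D] of the points lay in the kernel of [u], their determinant would vanish. *)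
Lemma card_zero_ev (u : 'cV[R]_D) : u != 0 -> (#|[pred i | ev (x i) u == 0%R]| <= d)%N.
Proof.
move=> u0; rewrite leqNgt; apply/negP => big.
pose t (j : 'I_D) : I := enum_val (widen_ord big j).
have t_inj : injective t.
  by move=> j j' /enum_val_inj /(congr1 val) /= e; apply: val_inj.
have /eqP := gp t_inj; apply; apply: rowsdet_ev u0 _ => j.
by have := enum_valP (widen_ord big j); rewrite inE => /eqP.
Qed.

Variable (M : nat).
Local Notation Q := {ffun 'I_M -> I}.
Local Notation S := {ffun 'I_D -> 'I_M}.
Local Notation Be := {ffun 'I_D -> 'I_B}.

(** The hyperplanes of round [r]. Including the sample [q] in the index lets a cutting be taken
    before a sample is fixed. *)
Definition mixed_cof W (r : 'I_D) (w : Q * S * Be) : 'cV[R]_D :=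
  cof (mixed r W (w.1.1 \o w.1.2) w.2) r.

Section Rounds.
Variables (E h : nat).
Local Notation L := (label d (h + D)).
Let u := (B * d)%N.
Hypotheses (E_gt0 : (0 < E)%N) (leuh : (u <= h)%N)
  (card_L : (#|L| * E.-1 ^ (h - u) < E ^ (h - u))%N).
Hypothesis Om_gt0 : (0 < #|{: Q * S * Be}|)%N.

Definition round_spec (cls : nat -> I -> L) (V : nat -> L -> 'I_B -> 'rV[R]_D)
    (r : 'I_D) : Prop :=
  forall i, in_cone (V r (cls r i)) (x i) /\
    (#|[set w | crosses (V r (cls r i)) (mixed_cof (fun j i => V j (cls j i)) r w)]| * E
      <= #|{: Q * S * Be}|)%N.

(** The hyperplanes of a round depend only on cones of earlier rounds, so later rounds do not
    disturb them. *)
Lemma mixed_cof_eq W W' (r : 'I_D) : (forall j, (j < r)%N -> W j = W' j) ->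
  mixed_cof W r =1 mixed_cof W' r.
Proof.
by move=> WW' w; apply: cof_eq => j _; rewrite /mixed; case: ifP => // /WW' ->.
Qed.

Lemma rounds : exists cls V, forall r : 'I_D, round_spec cls V r.
Proof.
suff H k : exists cls V, forall r : 'I_D, (r < k)%N -> round_spec cls V r.
  by have [cls [V h']] := H D; exists cls, V => r; apply: h'.
elim: k => [|k [cls [V IH]]].
  pose l0 : L := [ffun=> (false, [ffun=> rshift h ord0])].
  by exists (fun _ _ => l0), (fun _ _ _ => 0).
case: (ltnP k D) => kD; last first.
  by exists cls, V => r rk; apply: IH; apply: leq_trans (ltn_ord r) kD.
have [c [v cv]] := @cutting R d _ I (mixed_cof (fun j i => V j (cls j i)) (Ordinal kD))
  x E h Om_gt0 E_gt0 leuh card_L x_neq0.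
pose cls' j := if j == k then c else cls j.
pose V' j := if j == k then v else V j.
exists cls', V' => r rk i.
have mE : mixed_cof (fun j i => V' j (cls' j i)) r =1
          mixed_cof (fun j i => V j (cls j i)) r.
  apply: mixed_cof_eq => j jr; rewrite /V' /cls' ltn_eqF //.
  by apply: leq_trans jr _; rewrite -ltnS.
set A := [set _ | _].
have -> : A = [set w | crosses (V' r (cls' r i)) (mixed_cof (fun j i => V j (cls j i)) r w)].
  by apply/setP => w; rewrite !inE mE.
case: (eqVneq (val r) k) => rk'.
  have -> : r = Ordinal kD by apply: val_inj.
  by rewrite /V' /cls' /= eqxx; apply: cv.
rewrite /V' /cls' (negPf rk'); apply: IH.
by rewrite ltn_neqAle rk' -ltnS.
Qed.

End Rounds.

Section GoodSample.
Variables (L : finType) (cls : nat -> I -> L) (V : nat -> L -> 'I_B -> 'rV[R]_D).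
Let W j i := V j (cls j i).
Let full i : {ffun 'I_D -> L} := [ffun r => cls (val r) i].
Variable w : nat.

Definition class i : {set I} := [set i' | full i' == full i].

(** The first two conditions put a sampled point strictly on one side of hyperplanes that do not
    cross its cone; the last one gives each class a fixed share of the points. *)
Definition good (q : Q) : Prop :=
  [/\ forall (r : 'I_D) (s : S) (be : Be), injective s ->
        ~~ crosses (V r (cls r (q (s r)))) (mixed_cof W r (q, s, be)),
      forall (r : 'I_D) (s : S) (be : Be), injective s ->
        mixed_cof W r (q, s, be) != 0 ->
        ev (x (q (s r))) (mixed_cof W r (q, s, be)) != 0,
      injective q &
      forall j, (#|I| <= #|class (q j)| * (w * #|{ffun 'I_D -> L}|))%N].

Section SignOfGoodSample.
Hypothesis covered : forall (r : 'I_D) i, in_cone (W r i) (x i).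

Variables (q : Q).
Hypothesis q_good : good q.

(** Rows are replaced by generators one by one. In round [r] the hyperplane of the other rows does
    not cross the cone of the point, so the generators lie weakly on the side of the point. *)
Lemma mixed_sign (s : S) r be : injective s -> (r <= D)%N ->
  0 <= rowsdet (x \o q \o s) * rowsdet (mixed r W (q \o s) be).
Proof.
move=> s_inj; have [nc nz _ _] := q_good.
elim: r be => [|r IH] be rD.
  by rewrite -(@eq_rowsdet _ _ (x \o q \o s) (mixed 0 W (q \o s) be)) // -expr2 sqr_ge0.
pose r' : 'I_D := Ordinal rD; set sg := rowsdet (x \o q \o s).
have cofE : cof (mixed r.+1 W (q \o s) be) r' = mixed_cof W r' (q, s, be).
  apply: cof_eq => j jr; rewrite /mixed ltnS leq_eqVlt.
  by have /negPf -> : val j != r by apply: contra jr => /eqP e; apply/eqP/val_inj.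
have := IH be (ltnW rD); rewrite [rowsdet (mixed r _ _ _)](rowsdetE _ r').
rewrite [rowsdet (mixed r.+1 _ _ _)](rowsdetE _ r') cofE.
rewrite -[cof (mixed r _ _ _) r']/(mixed_cof W r' (q, s, be)).
rewrite /mixed /= ltnn ltnSn.
set U := mixed_cof _ _ _; case: (eqVneq U 0) => [-> _|U0].
  by rewrite /ev mulmx0 mxE mulr0.
have := nz r' s be s_inj U0; have := nc r' s be s_inj; rewrite -/U.
have := covered r' (q (s r')); rewrite /W.
set VV := V _ _ => xV ncV xU0 sgx.
have evV b : ev b (sg *: U) = sg * ev b U by rewrite /ev -scalemxAr mxE.
rewrite -evV; apply: (uncrossed_ge0 xV).
- apply: contra ncV => /existsP[b /existsP[b']]; rewrite !evV => /andP[h1 h2].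
  have [s0|s0|s0] := ltrgt0P sg; last by rewrite s0 mul0r ltxx in h1.
    apply/existsP; exists b; apply/existsP; exists b'.
    by move: h1 h2; rewrite pmulr_rlt0 // pmulr_rgt0 // => -> ->.
  apply/existsP; exists b'; apply/existsP; exists b.
  by move: h1 h2; rewrite nmulr_rlt0 // nmulr_rgt0 // => -> ->.
- rewrite evV lt_neqAle sgx andbT eq_sym mulf_neq0 //.
  have [_ _ q_inj _] := q_good; have := gp (inj_comp q_inj s_inj).
  by rewrite -(@eq_rowsdet _ _ (x \o q \o s)).
Qed.

(** Points of the same classes have the same generators, so [mixed_sign] covers all generator rows.
    Going back from the last row to the first, each row of generators is replaced by the point of
    [q'], a nonnegative combination of them. *)
Lemma class_sign_ge0 (s : S) (q' : 'I_D -> I) : injective s ->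
  (forall m, q' m \in class (q (s m))) ->
  0 <= rowsdet (x \o q \o s) * rowsdet (x \o q').
Proof.
move=> s_inj q'P; set sg := rowsdet (x \o q \o s).
suff H r be : (r <= D)%N -> 0 <= sg * rowsdet (mixed (D - r) W q' be).
  have B0 : (0 < B)%N by rewrite expn_gt0.
  have := H D [ffun=> Ordinal B0] (leqnn _); rewrite subnn.
  by rewrite -(@eq_rowsdet _ _ (x \o q')).
elim: r be => [|r IH] be rD.
  rewrite subn0; have := mixed_sign be s_inj (leqnn _); rewrite -/sg.
  rewrite (@eq_rowsdet _ _ (mixed _ _ (_ \o _) _) (mixed D W q' be)) // => j.
  rewrite /mixed ltn_ord /W; have := q'P j; rewrite inE => /eqP/ffunP/(_ j).
  by rewrite !ffunE => ->.
set k := (D - r.+1)%N; have kD : (k < D)%N by rewrite /k; lia.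
have kE : (D - r)%N = k.+1 by rewrite /k; lia.
pose k' : 'I_D := Ordinal kD.
rewrite (rowsdetE _ k'); set U := cof _ _.
have -> : mixed k W q' be k' = x (q' k') by rewrite /mixed ltnn.
have evV b : ev b (sg *: U) = sg * ev b U by rewrite /ev -scalemxAr mxE.
rewrite -evV; apply: in_cone_ge0 (covered k' (q' k')) _ => b; rewrite evV.
have := IH (upd be k' b) (ltnW rD); rewrite kE (rowsdetE _ k').
have -> : mixed k.+1 W q' (upd be k' b) k' = W k' (q' k') b.
  by rewrite /mixed ltnSn upd_id.
congr (0 <= sg * ev _ _); apply: cof_eq => j jk; rewrite /mixed ltnS leq_eqVlt.
have /negPf -> : val j != k by apply: contra jk => /eqP e; apply/eqP/val_inj.
by rewrite upd_neq.
Qed.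

(** General position gives strictness once [q'] is injective. Two equal values would force two
    sampled points into one class; exchanging these points would then be allowed by
    [class_sign_ge0], although it reverses the sign. *)
Lemma class_sign_gt0 (s : S) (q' : 'I_D -> I) : injective s ->
  (forall m, q' m \in class (q (s m))) ->
  0 < rowsdet (x \o q \o s) * rowsdet (x \o q').
Proof.
move=> s_inj q'P; have [_ _ q_inj _] := q_good.
have sg0 : rowsdet (x \o q \o s) != 0.
  have := gp (inj_comp q_inj s_inj).
  by rewrite -(@eq_rowsdet _ _ (x \o q \o s)).
rewrite lt_neqAle class_sign_ge0 // andbT eq_sym mulf_neq0 //; apply: gp.
move=> a b ab; apply/eqP; apply: contraT => ne.
have fab : full (q (s a)) = full (q (s b)).
  have := q'P a; have := q'P b; rewrite !inE ab => /eqP <-.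
  by move=> /eqP.
have : 0 <= rowsdet (x \o q \o s) * rowsdet (x \o (q \o s \o tperm a b)).
  apply: class_sign_ge0 => // m; rewrite inE /=; apply/eqP.
  by case: tpermP => [->|->|].
have -> : rowsdet (x \o (q \o s \o tperm a b)) = - rowsdet (x \o q \o s).
  by rewrite -(rowsdet_tperm _ ne); apply: eq_rowsdet.
by rewrite mulrN oppr_ge0 -expr2 leNgt exprn_even_gt0 //= sg0.
Qed.

End SignOfGoodSample.

Variable E : nat.
Hypothesis EE : E = (w * (#|S| * #|Be|))%N.
Hypothesis cross_few : forall (r : 'I_D) i,
  (#|[set o | crosses (V r (cls r i)) (mixed_cof W r o)]| * E <= #|{: Q * S * Be}|)%N.
Hypothesis large1 : (w * d <= #|I|)%N.
Hypothesis large2 : (w <= #|I|)%N.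
Hypothesis w_large :
  (#|{: 'I_D * S * Be}| + #|{: 'I_D * S * Be}| + #|{: 'I_M * 'I_M}| + #|'I_M| < w)%N.
Hypothesis M_gt0 : (0 < M)%N.

Lemma mixed_cof_upd (r : 'I_D) (q : Q) (s : S) be i : injective s ->
  mixed_cof W r (upd q (s r) i, s, be) = mixed_cof W r (q, s, be).
Proof.
move=> s_inj; apply: cof_eq => j jr; rewrite /mixed /= upd_neq //.
by apply: contra jr => /eqP/s_inj ->.
Qed.

(** Each failure of a condition has probability at most 1/[w], as seen by resampling one coordinate
    of [q]. *)
Lemma exists_good : exists q, good q.
Proof.
have I0 : (0 < #|I|)%N by lia.
pose badc (e : 'I_D * S * Be) (q : Q) i := injectiveb e.1.2 &&
  crosses (V e.1.1 (cls e.1.1 i)) (mixed_cof W e.1.1 (q, e.1.2, e.2)).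
pose badz (e : 'I_D * S * Be) (q : Q) i := [&& injectiveb e.1.2,
  mixed_cof W e.1.1 (q, e.1.2, e.2) != 0 &
  ev (x i) (mixed_cof W e.1.1 (q, e.1.2, e.2)) == 0].
pose bade (e : 'I_M * 'I_M) (q : Q) i := (e.1 != e.2) && (i == q e.2).
pose bads (q : Q) i := (#|class i| * (w * #|{ffun 'I_D -> L}|) < #|I|)%N.
pose bad (z : ('I_D * S * Be) + ('I_D * S * Be) + ('I_M * 'I_M) + 'I_M) : pred Q :=
  match z with
  | inl (inl (inl e)) => [pred q | badc e q (q (e.1.2 e.1.1))]
  | inl (inl (inr e)) => [pred q | badz e q (q (e.1.2 e.1.1))]
  | inl (inr e) => [pred q | bade e q (q e.1)]
  | inr j => [pred q | bads q (q j)]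
  end.
have [z|||q qP] := @exists_avoiding_uniform _ _ bad w.
- rewrite -(leq_pmul2l I0) mulnA.
  case: z => [[[[[r s] be]|[[r s] be]]|[j j']]|j].
  + have -> : (#|I| * #|bad (inl (inl (inl (r, s, be))))| =
               \sum_i #|[pred q | badc (r, s, be) q i]|)%N.
      apply: (@card_resample _ _ (s r) (badc (r, s, be))) => q i i'.
      rewrite /badc /=; case: injectiveP => //= s_inj.
      by rewrite mixed_cof_upd.
    rewrite big_distrl -sum_nat_const /=; apply: leq_sum => i _.
    have SB : (0 < #|S| * #|Be|)%N.
      rewrite muln_gt0; apply/andP; split; apply/card_gt0P.
        by exists [ffun=> Ordinal M_gt0].
      have B0 : (0 < B)%N by rewrite expn_gt0.
      by exists [ffun=> Ordinal B0].
    (* [cross_few] counts over all [q], [s] and [be]; fixing [s] and [be] costs the factor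
       [#|S| * #|Be|] contained in [E]. *)
    rewrite -(leq_pmul2r SB) -mulnA -EE; have := cross_few r i.
    rewrite !card_prod -mulnA; apply: leq_trans; rewrite leq_mul2r; apply/orP; right.
    set A := [pred q | _]; rewrite -(card_imset A (_ : injective (fun q : Q => (q, s, be)))).
      apply/subset_leq_card/fintype.subsetP => _ /imsetP[q qA ->]; rewrite inE.
      by move: qA; rewrite inE => /andP[].
    by move=> q q' [].
  + rewrite [leqRHS]mulnC; apply: (@card_resample_le _ _ (s r) (badz (r, s, be))) => [q i i'|q].
      by rewrite /badz /=; case: injectiveP => //= s_inj; rewrite mixed_cof_upd.
    set U := mixed_cof W r (q, s, be).
    case: (boolP (injectiveb s && (U != 0))) => [/andP[_ u0]|nu]; last first.
      suff -> : #|[pred i | badz (r, s, be) q i]| = 0%N by [].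
      by apply: eq_card0 => i; rewrite !inE /badz /= andbA (negPf nu).
    apply: (@leq_trans (#|[pred i | ev (x i) U == 0%R]| * w)).
      rewrite leq_mul2r; apply/orP; right; apply/subset_leq_card/fintype.subsetP => i.
      by rewrite !inE => /and3P[].
    by apply: leq_trans large1; rewrite mulnC leq_mul2l card_zero_ev ?orbT.
  + rewrite [leqRHS]mulnC; apply: (@card_resample_le _ _ j (bade (j, j'))) => [q i i'|q].
      rewrite /bade /=; case: (eqVneq j j') => //= ne; rewrite upd_neq //.
      by rewrite eq_sym.
    apply: leq_trans large2; rewrite -[leqRHS]mul1n leq_mul2r.
    rewrite (leq_trans (subset_leq_card _) (_ : #|pred1 (q j')| <= 1)%N) ?orbT //.
      by apply/fintype.subsetP => i; rewrite !inE => /andP[].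
    by rewrite card1.
  + rewrite [leqRHS]mulnC; apply: (@card_resample_le _ _ j bads) => // q.
    have LF : (0 < #|{ffun 'I_D -> L}|)%N.
      by have /card_gt0P[i _] := I0; apply/card_gt0P; exists (full i).
    rewrite -(leq_pmul2r LF) -mulnA.
    (* Sort the points by class: a small class has fewer than [#|I|]/[K] points, and there are at
       most [#|{ffun 'I_D -> L}|] classes. *)
    set K := (w * _)%N.
    pose P (la : {ffun 'I_D -> L}) := [pred i | bads q i && (full i == la)].
    apply: (@leq_trans ((\sum_la #|P la|) * K)).
      rewrite leq_mul2r; apply/orP; right; apply: leq_card_exists => i bi.
      by exists (full i); rewrite /P /= eqxx andbT.
    rewrite [leqRHS]mulnC big_distrl -sum_nat_const /=; apply: leq_sum => la _.
    case: (pickP (P la)) => [i|P0]; last by rewrite (eq_card0 P0).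
    rewrite /P /= => /andP[bi /eqP fi]; apply: leq_trans (ltnW bi).
    rewrite leq_mul2r; apply/orP; right; apply/subset_leq_card/fintype.subsetP => i'.
    by rewrite !inE fi => /andP[].
- by rewrite !card_sum.
- by rewrite card_ffun expn_gt0 I0.
exists q; split.
- move=> r s be s_inj; have := qP (inl (inl (inl (r, s, be)))).
  by rewrite /= /badc /=; case: injectiveP.
- move=> r s be s_inj u0; have := qP (inl (inl (inr (r, s, be)))).
  by rewrite /= /badz /= u0; case: injectiveP.
- move=> j j' e; apply/eqP; have := qP (inl (inr (j, j'))).
  by rewrite /= /bade /= e eqxx andbT negbK.
- by move=> j; have := qP (inr j); rewrite /= /bads -leqNgt.
Qed.

End GoodSample.

(** The bound on [w] counts bad events: [D * SB] crossings, as many incidences, [M * M] coincidences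
    and [M] small classes. *)
Lemma homogeneous_classes (w E h : nat) : (0 < M)%N ->
  let SB := (M ^ D * B ^ D)%N in
  (2 * (D * SB) + M * M + M < w)%N -> E = (w * SB)%N ->
  (B * d <= h)%N ->
  (#|label d (h + D)| * E.-1 ^ (h - B * d) < E ^ (h - B * d))%N ->
  (w * d <= #|I|)%N -> (w <= #|I|)%N ->
  exists (q : 'I_M -> I) (C : 'I_M -> {set I}), [/\ injective q,
    forall j, (#|I| <= #|C j| * (w * #|label d (h + D)| ^ D))%N &
    forall (s : 'I_D -> 'I_M) (q' : 'I_D -> I), injective s ->
      (forall m, q' m \in C (s m)) ->
      0 < rowsdet (x \o q \o s) * rowsdet (x \o q')].
Proof.
move=> M0 SB w_large EE leuh card_L large1 large2.
have cS : #|S| = (M ^ D)%N by rewrite card_ffun !card_ord.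
have cBe : #|Be| = (B ^ D)%N by rewrite card_ffun !card_ord.
have cF : #|{ffun 'I_D -> label d (h + D)}| = (#|label d (h + D)| ^ D)%N.
  by rewrite card_ffun card_ord.
have SB0 : (0 < SB)%N by rewrite muln_gt0 !expn_gt0 M0.
have E0 : (0 < E)%N by rewrite EE muln_gt0 SB0 andbT; lia.
have Om0 : (0 < #|{: Q * S * Be}|)%N.
  rewrite !card_prod cS cBe -mulnA muln_gt0 SB0 andbT card_ffun expn_gt0.
  by rewrite (leq_trans _ large2) //; lia.
have [cls [V rP]] := @rounds E h E0 leuh card_L Om0.
have EE' : E = (w * (#|S| * #|Be|))%N by rewrite cS cBe.
have [|q qg] := @exists_good _ cls V w E EE' (fun r i => (rP r i).2) large1 large2 _ M0.
  by rewrite !card_prod cS cBe !card_ord -!mulnA -/SB; lia.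
exists q, (fun j => class cls (q j)); split.
- by have [] := qg.
- have [_ _ _ cq] := qg => j; have := cq j.
  by rewrite cF.
- move=> s q' s_inj q'P; pose sf : S := finfun s.
  have sfE : sf =1 s by move=> i; rewrite ffunE.
  have := class_sign_gt0 (fun r i => (rP r i).1) qg (s := sf) (q' := q').
  rewrite (@eq_rowsdet _ _ (x \o q \o sf) (x \o q \o s)) => [|i]; last first.
    by rewrite /= sfE.
  apply=> [i j|m]; first by rewrite !sfE => /s_inj.
  by rewrite sfE.
Qed.

End Homogeneous.

(** * Selecting mutually avoiding families *)

Lemma pigeonhole (T L : finType) (f : T -> L) k :
  (0 < k)%N -> (0 < #|L|)%N -> (k * #|L| <= #|T|)%N ->
  exists l, (k <= #|[pred t | f t == l]|)%N.
Proof.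
move=> k0 L0 kL; apply/existsP; apply: contraLR kL => /existsPn lt.
have le1 : (#|T| <= \sum_l #|[pred t | f t == l]|)%N.
  by apply: leq_card_exists => t _; exists (f t) => /=.
rewrite -ltnNge; apply: leq_ltn_trans le1 _.
apply: (@leq_ltn_trans (\sum_(l : L) k.-1)).
  by apply: leq_sum => l _; have := lt l; lia.
by rewrite sum_nat_const mulnC ltn_pmul2r // prednK.
Qed.

Definition ext (T : Type) d (z : 'I_d -> T) (v : T) (i : 'I_d.+1) : T :=
  if unlift ord_max i is Some i' then z i' else v.

Lemma ext_inj (T : Type) d (z : 'I_d -> T) v :
  injective z -> (forall i, z i <> v) -> injective (ext z v).
Proof.
move=> z_inj zv i j; rewrite /ext.
case: unliftP => [i' ->|->]; case: unliftP => [j' ->|->] //.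
- by move/z_inj ->.
- by move/zv.
- by move/esym/zv.
Qed.

Lemma comp_ext (T U : Type) d (f : T -> U) (z : 'I_d -> T) v :
  f \o ext z v =1 ext (f \o z) (f v).
Proof. by move=> i; rewrite /ext /=; case: unlift. Qed.

Section Selection.
Variables (R : realFieldType) (d : nat).
Local Notation D := d.+1.
Implicit Types (z : 'I_d -> 'rV[R]_D) (v : 'rV[R]_D).

Definition orient z v : R := rowsdet (ext z v).

(** The last row 0 is a placeholder that the cofactors along it ignore. *)
Definition span_functional z : 'cV[R]_D := cof (ext z 0) ord_max.

Lemma orientE z v : orient z v = ev v (span_functional z).
Proof.
rewrite /orient (rowsdetE _ ord_max) {1}/ext unlift_none.
by congr ev; apply: cof_eq => i; rewrite /ext eq_sym => /unlift_some[j _ ->].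
Qed.

Lemma orient_mem z j : orient z (z j) = 0.
Proof.
apply: (@determinant_alternate _ _ _ (lift ord_max j) ord_max).
  by rewrite eq_sym neq_lift.
by move=> i; rewrite !mxE /ext liftK unlift_none.
Qed.

(** By pigeonhole [k] of the points [v] share a label for the arrangement of all hyperplanes spanned
    by [y], and thus lie on the same side of each. *)
Lemma select_avoided (p n k : nat) (y : 'I_p -> 'rV[R]_D) (v : 'I_n -> 'rV[R]_D) :
  (0 < k)%N -> (k * #|label d (p ^ d + D)| <= n)%N ->
  (forall (s : 'I_d -> 'I_p) j, injective s -> orient (y \o s) (v j) != 0) ->
  (forall j, v j != 0) ->
  exists2 b : 'I_k -> 'I_n, injective b &
    forall (s : 'I_d -> 'I_p) j j', injective s ->
      0 < orient (y \o s) (v (b j)) * orient (y \o s) (v (b j')).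
Proof.
move=> k0 kn nz v0.
have cF : #|{ffun 'I_d -> 'I_p}| = (p ^ d)%N by rewrite card_ffun !card_ord.
pose g (a : 'I_(p ^ d)) := span_functional (y \o enum_val (cast_ord (esym cF) a)).
have /fin_all_exists[lab labP] : forall j, exists l : label d (p ^ d + D),
   in_cone (rays (with_coords g) l) (v j) /\
   forall a, ~~ crosses (rays (with_coords g) l) (with_coords g a).
  by move=> j; apply: exists_label => //; apply: with_coords_spanning.
have L0 : (0 < #|label d (p ^ d + D)|)%N.
  by rewrite card_label expn_gt0 muln_gt0 expn_gt0 addnS.
have [|l lk] := @pigeonhole _ _ lab k k0 L0; first by rewrite card_ord.
exists (fun j => enum_val (widen_ord lk j)).
  by move=> j j' /enum_val_inj/(congr1 val)/= e; apply: val_inj.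
move=> s j j' s_inj; pose sf : {ffun 'I_d -> 'I_p} := finfun s.
set b := enum_val _; set b' := enum_val _.
have lb : lab b = l by have := enum_valP (widen_ord lk j); rewrite inE => /eqP.
have lb' : lab b' = l by have := enum_valP (widen_ord lk j'); rewrite inE => /eqP.
have [c nc] := labP b; have [c' _] := labP b'.
rewrite lb in c nc; rewrite lb' in c'.
have := nz s b s_inj; have := nz s b' s_inj; rewrite !orientE.
have -> : span_functional (y \o s) = with_coords g (lshift D (cast_ord cF (enum_rank sf))).
  rewrite with_coords_lshift /g cast_ordK enum_rankK; apply: cof_eq => i _.
  by rewrite /ext; case: unlift => // a; rewrite /= ffunE.
by move=> h' h; apply: (same_label_sign c c').
Qed.

(** [b] is chosen against all [m] points, so its property survives the later choice of [a] among
    them, which is made against [b] alone. *)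
Lemma select_mutually_avoiding (m n k : nat) (y : 'I_(m + n) -> 'rV[R]_D) :
  (0 < k)%N -> (k * #|label d (k ^ d + D)| <= m)%N ->
  (k * #|label d (m ^ d + D)| <= n)%N -> (forall j, y j != 0) ->
  (forall s : 'I_D -> 'I_(m + n), injective s -> rowsdet (y \o s) != 0) ->
  exists a b : 'I_k -> 'I_(m + n), [/\ injective a, injective b,
    forall i j, a i <> b j,
    forall (s : 'I_d -> 'I_k) j j', injective s ->
      0 < orient (y \o a \o s) (y (b j)) * orient (y \o a \o s) (y (b j')) &
    forall (s : 'I_d -> 'I_k) j j', injective s ->
      0 < orient (y \o b \o s) (y (a j)) * orient (y \o b \o s) (y (a j'))].
Proof.
move=> k0 km kn y0 gp.
have lr (i : 'I_m) (j : 'I_n) : lshift n i <> rshift m j.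
  by move=> /(congr1 val) /= e; have := ltn_ord i; lia.
have gpe (s : 'I_d -> 'I_(m + n)) (v : 'I_(m + n)) : injective s -> (forall i, s i <> v) ->
    orient (y \o s) (y v) != 0.
  move=> s_inj sv; have := gp _ (ext_inj s_inj sv).
  by rewrite (eq_rowsdet (comp_ext y s v)).
have [s j s_inj||b b_inj bP] := @select_avoided m n k (y \o @lshift m n)
    (y \o @rshift m n) k0 kn.
- have := gpe _ (rshift m j) (inj_comp (@lshift_inj m n) s_inj); apply=> i; exact: lr.
- by move=> j; apply: y0.
have [s j s_inj||a a_inj aP] := @select_avoided k m k (y \o @rshift m n \o b)
    (y \o @lshift m n) k0 km.
- have := gpe _ (lshift n j) (inj_comp (@rshift_inj m n) (inj_comp b_inj s_inj)).
  by apply=> i /esym; apply: lr.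
- by move=> j; apply: y0.
exists (@lshift m n \o a), (@rshift m n \o b); split.
- exact: inj_comp (@lshift_inj m n) a_inj.
- exact: inj_comp (@rshift_inj m n) b_inj.
- by move=> i j; apply: lr.
- by move=> s j j' s_inj; have := bP (a \o s) j j' (inj_comp a_inj s_inj).
- by move=> s j j' s_inj; have := aP s j j' s_inj.
Qed.

End Selection.

(** * Polynomial bounds and choice of parameters *)

Section PolynomialBounds.
Local Open Scope nat_scope.

(** A pure power suffices: for [k] at least 2, constants are absorbed by the exponent. *)
Definition poly_bounded (f : nat -> nat) : Prop :=
  exists c, forall k, 2 <= k -> f k <= k ^ c.

Lemma poly_bounded_const a : poly_bounded (fun=> a).
Proof.
exists a => k k2; apply: leq_trans (ltnW (ltn_expl a (isT : 1 < 2))) _.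
by case: a => // a; rewrite leq_exp2r.
Qed.

Lemma poly_bounded_id : poly_bounded id.
Proof. by exists 1. Qed.

Lemma poly_boundedD f g : poly_bounded f -> poly_bounded g ->
  poly_bounded (fun k => f k + g k).
Proof.
move=> [c fc] [c' gc]; exists (maxn c c').+1 => k k2.
have k0 : 0 < k by lia.
have le1 : f k <= k ^ maxn c c'.
  by apply: leq_trans (fc k k2) _; rewrite leq_pexp2l // leq_maxl.
have le2 : g k <= k ^ maxn c c'.
  by apply: leq_trans (gc k k2) _; rewrite leq_pexp2l // leq_maxr.
rewrite expnS; move: (k ^ _) le1 le2 => K; nia.
Qed.

Lemma poly_boundedM f g : poly_bounded f -> poly_bounded g ->
  poly_bounded (fun k => f k * g k).
Proof.
move=> [c fc] [c' gc]; exists (c + c') => k k2.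
by rewrite expnD leq_mul ?fc ?gc.
Qed.

Lemma poly_boundedX f e : poly_bounded f -> poly_bounded (fun k => f k ^ e).
Proof.
move=> [c fc]; exists (c * e) => k k2; rewrite expnM.
by case: e => // e; rewrite leq_exp2r // fc.
Qed.

Lemma expn_lt_exp2 a : exists s0, forall s, s0 <= s -> s ^ a < 2 ^ s.
Proof.
case: a => [|a].
  by exists 1 => s s0; rewrite expn0 -{1}(expn0 2) ltn_exp2l.
exists (2 ^ (4 * a.+1)) => s les.
have s0 : 0 < s by apply: leq_trans les; rewrite expn_gt0.
set j := trunc_log 2 s.
have js : 2 ^ j <= s by apply: trunc_logP.
have sj : s < 2 ^ j.+1 by apply: trunc_log_ltn.
have ja : 4 * a.+1 <= j by apply: trunc_log_max.
apply: (@leq_trans (2 ^ (j.+1 * a.+1))); first by rewrite expnM ltn_exp2r.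
rewrite leq_exp2l //; apply: leq_trans js.
(* Splitting the exponent in halves bounds 2^[j] below by a quadratic in [j], which beats ([j] +
   1)([a] + 1) as [j] is at least 4([a] + 1). *)
have -> : j = j./2 + (j - j./2) by lia.
set p := j./2; set q := j - p; rewrite expnD.
have p1 : p < 2 ^ p by apply: ltn_expl.
have q1 : q < 2 ^ q by apply: ltn_expl.
apply: leq_trans (leq_mul p1 q1).
have : p + q = j by rewrite /q /p; lia.
have : j <= 2 * p + 1 by rewrite /p; lia.
have : p <= q by rewrite /q /p; lia.
move: ja; clearbody p q j; nia.
Qed.

(** With [m] = [E] - 1, the first two binomial terms of ([m] + 1)^([m] + 1) are each at least
    [m]^([m] + 1). *)
Lemma double_expn_pred E : 0 < E -> 2 * E.-1 ^ E <= E ^ E.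
Proof.
case: E => // -[|n] _ //.
set m := n.+1; rewrite -[m.+1.-1]/m -[in X in _ <= X ^ _]addn1 expnDn.
rewrite (bigD1 ord0) //= bin0 subn0 mul1n exp1n muln1.
have lt1 : 1 < m.+2 by [].
rewrite (bigD1 (Ordinal lt1)) //= bin1 exp1n muln1 addnA.
apply: leq_trans (leq_addr _ _).
rewrite mul2n -addnn leq_add2l subSS subn0 expnS leq_mul2r.
by rewrite leqnSn orbT.
Qed.

(** Writing [h] - 2^[d] [d] = [E] [s], the ratio of the two powers is at least 2^[s] by
    [double_expn_pred], while the number of labels is polynomial in [s] because [E] is at most
    [s]. *)
Lemma label_count_lt d : exists s0, forall E h, 0 < E ->
  h = 2 ^ d * d + E * (E + s0) ->
  #|label d (h + d.+1)| * E.-1 ^ (h - 2 ^ d * d) < E ^ (h - 2 ^ d * d).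
Proof.
have [s1 s1P] := expn_lt_exp2 ((3 * d + 1) * 2 ^ d).
exists (s1 + (2 ^ d * d + d.+1) + 2) => E h E0 hdef.
set s := E + (s1 + (2 ^ d * d + d.+1) + 2).
have hE : h - 2 ^ d * d = E * s by rewrite hdef addKn.
rewrite hE !expnM.
have le2 : 2 ^ s * (E.-1 ^ E) ^ s <= (E ^ E) ^ s.
  rewrite -expnMn leq_exp2r ?double_expn_pred // /s; lia.
have [->|pos] := posnP ((E.-1 ^ E) ^ s); first by rewrite muln0 !expn_gt0 E0.
apply: leq_trans le2.
have Lt : #|label d (h + d.+1)| < 2 ^ s.
  apply: leq_ltn_trans (s1P s _); last by rewrite /s; lia.
  rewrite card_label expnM leq_exp2r ?expn_gt0 //.
  have sb : 2 <= s by rewrite /s; lia.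
  apply: (@leq_trans (s * (s ^ 3) ^ d)); last first.
    by rewrite -expnM -expnS addn1.
  rewrite leq_mul //; have [->//|d0] := posnP d; rewrite leq_exp2r //.
  have s_large : 2 ^ d * d + d.+1 + E <= s by rewrite /s; lia.
  have Es : E <= s by lia.
  have : h + d.+1 <= s + E * s by rewrite hdef -/s; lia.
  by rewrite !expnS expn0; nia.
by rewrite ltn_pmul2r.
Qed.

End PolynomialBounds.

(** [SB], [w], [E], [h] and the number of labels are each polynomial in the preceding quantities,
    starting from [M]. *)
Lemma homogeneous_size_poly d (M : nat -> nat) : poly_bounded M ->
  let SB k := (M k ^ d.+1 * (2 ^ d) ^ d.+1)%N in
  let w k := (2 * (d.+1 * SB k) + M k * M k + M k + 1)%N in
  exists h c, forall k, (2 <= k)%N -> (0 < M k)%N ->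
    [/\ (2 ^ d * d <= h k)%N,
      (#|label d (h k + d.+1)| * (w k * SB k).-1 ^ (h k - 2 ^ d * d)
         < (w k * SB k) ^ (h k - 2 ^ d * d))%N &
      (w k * #|label d (h k + d.+1)| ^ d.+1 <= k ^ c)%N].
Proof.
move=> polyM SB w; have [s0 s0P] := label_count_lt d.
have polySB : poly_bounded SB.
  by apply: poly_boundedM; [apply: poly_boundedX|apply: poly_bounded_const].
have polyw : poly_bounded w.
  apply: poly_boundedD; last exact: poly_bounded_const.
  apply: poly_boundedD => //; apply: poly_boundedD; last exact: poly_boundedM.
  apply: poly_boundedM; first exact: poly_bounded_const.
  by apply: poly_boundedM => //; apply: poly_bounded_const.
pose E k := (w k * SB k)%N; have polyE : poly_bounded E by apply: poly_boundedM.
pose h k := (2 ^ d * d + E k * (E k + s0))%N.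
have [c cP] : poly_bounded (fun k => (w k * ((2 * (h k + d.+1) ^ d) ^ 2 ^ d) ^ d.+1)%N).
  apply: poly_boundedM => //; do 2 apply: poly_boundedX.
  apply: poly_boundedM; first exact: poly_bounded_const.
  apply: poly_boundedX; apply: poly_boundedD; last exact: poly_bounded_const.
  apply: poly_boundedD; first exact: poly_bounded_const.
  by apply: poly_boundedM => //; apply: poly_boundedD => //; apply: poly_bounded_const.
exists h, c => k k2 M0; split.
- exact: leq_addr.
- apply: s0P => //; rewrite muln_gt0; apply/andP; split; first by rewrite /w addn1.
  by rewrite muln_gt0 !expn_gt0 M0.
- by rewrite card_label; apply: cP.
Qed.

(** * Combining selection with homogeneous classes *)

Lemma same_sign_transfer (R : realFieldType) (p p' r r' : R) :
  0 < p * r -> 0 < p' * r' -> 0 < p * p' -> 0 < r * r'.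
Proof.
move=> pr pr' pp; have : 0 < (p * r) * (p' * r') by rewrite mulr_gt0.
by rewrite mulrACA pmulr_rgt0.
Qed.

(** The selection is made among the sampled points; their classes are the required sets, since
    replacing points within classes preserves orientations. *)
Lemma mutually_avoiding_classes d : exists c, forall k, (2 <= k)%N ->
  exists n0, forall (R : realFieldType) (I : finType) (x : I -> 'rV[R]_d.+1),
  (forall t : 'I_d.+1 -> I, injective t -> rowsdet (x \o t) != 0) ->
  (forall i, x i != 0) -> (n0 <= #|I|)%N ->
  exists A B : 'I_k -> {set I},
  [/\ forall i, (#|I| <= #|A i| * k ^ c)%N,
      forall i, (#|I| <= #|B i| * k ^ c)%N &
      forall a b : 'I_k -> I, (forall i, a i \in A i) -> (forall i, b i \in B i) ->
      forall (s : 'I_d -> 'I_k) j j', injective s ->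
        0 < orient (x \o a \o s) (x (b j)) * orient (x \o a \o s) (x (b j')) /\
        0 < orient (x \o b \o s) (x (a j)) * orient (x \o b \o s) (x (a j'))].
Proof.
pose lab N := ((2 * N ^ d) ^ 2 ^ d)%N.
(* [m] and [n] are the least sizes that [select_mutually_avoiding] admits. *)
pose m k := (k * lab (k ^ d + d.+1))%N.
pose n k := (k * lab (m k ^ d + d.+1))%N.
have polylab f : poly_bounded f -> poly_bounded (fun k => k * lab (f k ^ d + d.+1))%N.
  move=> pf; apply: poly_boundedM; first exact: poly_bounded_id.
  apply: poly_boundedX; apply: poly_boundedM; first exact: poly_bounded_const.
  apply: poly_boundedX; apply: poly_boundedD; last exact: poly_bounded_const.
  exact: poly_boundedX.
have polym : poly_bounded m by apply: polylab; apply: poly_bounded_id.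
have [h [c hc]] := homogeneous_size_poly d (poly_boundedD polym (polylab m polym)).
exists c => k k2; have k0 : (0 < k)%N by lia.
have M0 : (0 < m k + n k)%N.
  by rewrite addn_gt0 /m muln_gt0 k0 /lab expn_gt0 muln_gt0 expn_gt0 addnS.
have [leuh card_L wc] := hc k k2 M0.
set M := (m k + n k)%N in M0 card_L wc *.
set SB := (M ^ d.+1 * _)%N in card_L wc *.
set w := (_ + 1)%N in card_L wc *.
exists (w * d + w)%N => R I x gp x0 nI.
have [|||q [C [q_inj Cn Csign]]] :=
  @homogeneous_classes R d I x gp x0 M w _ (h k) M0 _ erefl leuh card_L.
- by rewrite /w addn1.
- by apply: leq_trans nI; apply: leq_addr.
- by apply: leq_trans nI; apply: leq_addl.
have gpq s : injective s -> rowsdet ((x \o q) \o s) != 0.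
  by move=> s_inj; have := gp _ (inj_comp q_inj s_inj).
have [||al [be [al_inj be_inj albe sa sb]]] :=
  @select_mutually_avoiding R d (m k) (n k) k (x \o q) k0 _ _ (fun j => x0 _) gpq.
- by rewrite card_label.
- by rewrite card_label.
have Cbig j : (#|I| <= #|C j| * k ^ c)%N.
  by apply: leq_trans (Cn j) _; rewrite leq_mul2l wc orbT.
exists (C \o al), (C \o be); split=> [i|i|a b aC bC s j j' s_inj]; try exact: Cbig.
(* A sampled [d]-tuple and a further sampled point have the same orientation as any representatives
   of their classes. *)
have transfer (al' be' : 'I_k -> 'I_M) (a' b' : 'I_k -> I) i :
    injective al' -> (forall i j, al' i <> be' j) ->
    (forall i, a' i \in C (al' i)) -> (forall i, b' i \in C (be' i)) ->
    0 < orient (x \o q \o al' \o s) (x (q (be' i))) * orient (x \o a' \o s) (x (b' i)).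
  move=> al'_inj ne a'C b'C.
  have ext_i := @ext_inj _ _ (al' \o s) (be' i) (inj_comp al'_inj s_inj) (fun i' => @ne _ _).
  have := Csign _ (ext (a' \o s) (b' i)) ext_i.
  rewrite (@eq_rowsdet _ _ (x \o ext _ _) (ext (x \o a' \o s) (x (b' i)))); last first.
    exact: comp_ext.
  rewrite (@eq_rowsdet _ _ (_ \o ext _ _) (ext (x \o q \o al' \o s) (x (q (be' i))))); last first.
    exact: comp_ext.
  by apply=> m'; rewrite /ext; case: unlift => [i'|]; [apply: a'C|apply: b'C].
split.
  apply: (same_sign_transfer (transfer al be a b j _ _ _ _) (transfer al be a b j' _ _ _ _)) => //.
  exact: sa.
have beal i i' : be i <> al i' by move/esym; apply: albe.
apply: (same_sign_transfer (transfer be al b a j _ _ _ _) (transfer be al b a j' _ _ _ _)) => //.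
exact: sb.
Qed.

(** * Points in general position *)

Local Open Scope classical_set_scope.
Local Open Scope fset_scope.
Local Open Scope ring_scope.

Section Homogenization.
Variables (R : realType) (d : nat).
Implicit Types p : 'rV[R]_d.

Definition homog p : 'rV[R]_d.+1 :=
  \row_j (if unlift ord0 j is Some j' then p 0 j' else 1).

Lemma ev_homog p (u : 'cV[R]_d.+1) :
  ev (homog p) u = u ord0 0 + \sum_i p 0 i * u (lift ord0 i) 0.
Proof.
rewrite /ev mxE big_ord_recl !mxE unlift_none mul1r; congr (_ + _).
by apply: eq_bigr => i _; rewrite mxE liftK.
Qed.

Lemma homog_neq0 p : homog p != 0.
Proof.
apply/eqP => /rowP/(_ ord0)/eqP; by rewrite !mxE unlift_none oner_eq0.
Qed.

Lemma ev_homog_affine (J : finType) (w : J -> R) (t : J -> 'rV[R]_d) u :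
  \sum_j w j = 1 -> ev (homog (\sum_j w j *: t j)) u = \sum_j w j * ev (homog (t j)) u.
Proof.
move=> w1; under [RHS]eq_bigr do rewrite ev_homog mulrDr.
rewrite big_split /= -mulr_suml w1 mul1r ev_homog; congr (_ + _).
under [RHS]eq_bigr do rewrite mulr_sumr.
rewrite exchange_big /=; apply: eq_bigr => i _.
by rewrite summxE mulr_suml; apply: eq_bigr => j _; rewrite !mxE mulrA.
Qed.

(** A kernel vector of the determinant is the equation of a hyperplane through the points; its
    normal part [u] is nonzero, since otherwise the constant term would vanish too. *)
Lemma general_position_rowsdet (P : set 'rV[R]_d) (t : 'I_d.+1 -> 'rV[R]_d) :
  general_position P -> injective t -> (forall i, P (t i)) ->
  rowsdet (homog \o t) != 0.
Proof.
move=> gp t_inj tP; apply/negP => /eqP; rewrite /rowsdet -det_tr => /eqP/det0P[v v0 vt].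
have evt i : ev (homog (t i)) v^T = 0.
  have /matrixP/(_ 0 i) := vt; rewrite !mxE => vti; rewrite /ev mxE -[RHS]vti.
  by apply: eq_bigr => j _; rewrite !mxE mulrC.
pose u : 'cV[R]_d := \col_i v 0 (lift ord0 i).
have uE p : ev (homog p) v^T = v 0 ord0 + (p *m u) ord0 ord0.
  rewrite ev_homog !mxE; congr (_ + _); apply: eq_bigr => i _; by rewrite !mxE.
have [u0|u0] := eqVneq u 0.
  have v00 : v 0 ord0 = 0 by have := evt ord0; rewrite uE u0 mulmx0 mxE addr0.
  case/eqP: v0; apply/rowP => j; rewrite mxE.
  have [j' ->|->//] := unliftP ord0 j.
  by have /colP/(_ j') := u0; rewrite !mxE.
apply: (gp t t_inj tP [set p | (p *m u) ord0 ord0 = - v 0 ord0]).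
  by exists u, (- v 0 ord0).
by move=> i /=; have := evt i; rewrite uE addrC => /eqP; rewrite addr_eq0 => /eqP.
Qed.

Lemma ev_convex (u : 'cV[R]_d.+1) (a : R) :
  convex_set [set p : 'rV[R]_d | 0 < a * ev (homog p) u].
Proof.
apply/convex_setW => p q; rewrite !inE /= => hp hq t t0 t1.
pose w (b : bool) : R := if b then t%:num else 1 - t%:num.
pose z (b : bool) : 'rV[R]_d := if b then p else q.
have w1 : \sum_b w b = 1 by rewrite big_bool /w /= addrC subrK.
have := ev_homog_affine z u w1; rewrite !big_bool /w /z /= => e.
rewrite in_setE.
change (0 < a * ev (homog (t%:num *: p + (1 - t%:num) *: q)) u).
by rewrite e mulrDr !(mulrCA a) addr_gt0 // mulr_gt0 // subr_gt0.
Qed.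

(** The functional of a [d]-tuple of [a] vanishes on the affine hull of the tuple, whereas the
    convex hull of [b] lies in the open half-space containing [b j0]. *)
Lemma avoids_range (k : nat) (a b : 'I_k -> 'rV[R]_d) (j0 : 'I_k) :
  (forall (s : 'I_d -> 'I_k) j j', injective s ->
    0 < orient (homog \o a \o s) (homog (b j)) *
        orient (homog \o a \o s) (homog (b j'))) ->
  avoids (range a) (range b).
Proof.
move=> same t t_inj ta H [_ HE]; apply/seteqP; split=> // z [Hz zB].
have /boolp.choice[s sE] : forall i, exists j, a j = t i.
  by move=> i; have [j _] := ta i; exists j.
have s_inj : injective s.
  by move=> i i' e; apply: t_inj; rewrite -!sE e.
pose u := span_functional (homog \o a \o s).
have z0 : ev (homog z) u = 0.
  move: Hz; rewrite HE => -[w w1 ->]; rewrite ev_homog_affine //.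
  apply: big1 => i _; rewrite -sE -orientE.
  by rewrite -[homog _]/((homog \o a \o s) i) orient_mem mulr0.
suff : 0 < ev (homog (b j0)) u * ev (homog z) u by rewrite z0 mulr0 ltxx.
apply: (zB [set p | 0 < ev (homog (b j0)) u * ev (homog p) u]); split.
  exact: ev_convex.
by move=> _ [j _ <-] /=; rewrite -!orientE; apply: same.
Qed.

End Homogenization.

Theorem theorem1p7 (R : realType) (d : nat) (d_ge3 : (3 <= d)%N) :
  exists2 c : R, 0 < c &
  forall k : nat, (2 <= k)%N ->
  exists N : nat,
  forall P : {fset 'rV[R]_d},
    (N <= #|` P|)%N -> general_position [set` P] ->
  exists A B : 'I_k -> {fset 'rV[R]_d},
    [/\ forall i, (A i `<=` P)%fset /\
                  1 / (k%:R `^ c) * (#|` P|)%:R <= (#|` A i|)%:R :> R,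
        forall i, (B i `<=` P)%fset /\
                  1 / (k%:R `^ c) * (#|` P|)%:R <= (#|` B i|)%:R :> R
      & forall a b : 'I_k -> 'rV[R]_d,
          (forall i, a i \in A i) -> (forall i, b i \in B i) ->
          mutually_avoiding (range a) (range b)].
Proof.
have [c cP] := mutually_avoiding_classes d.
(* The successor keeps the constant positive even if [c] is 0. *)
exists c.+1%:R => [|k k2]; first by rewrite ltr0n.
have [N NP] := cP k k2; exists N => P NleP gp.
pose x (i : P) := homog (val i).
have cardP : #|{: P}| = #|` P| by rewrite cardfE.
have [t t_inj|i||A [B [An Bn AB]]] := NP R P x.
- apply: (general_position_rowsdet gp) => [i i' /val_inj/t_inj//|i].
  exact: valP.
- exact: homog_neq0.
- by rewrite cardP.
pose F (C : {set P}) : {fset 'rV[R]_d} := [fset val i | i in C].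
have F_sub C : F C `<=` P.
  by apply/fsubsetP => p /imfsetP[i _ ->]; apply: valP.
have F_card C : #|` F C| = #|C|.
  by rewrite card_imfset //=; [rewrite -cardE|apply: val_inj].
have F_large (C : {set P}) : (#|{: P}| <= #|C| * k ^ c)%N ->
    1 / (k%:R `^ c.+1%:R) * (#|` P|)%:R <= (#|` F C|)%:R :> R.
  move=> Cn; have k0 : 0 < (k%:R : R) ^+ c.+1 by rewrite exprn_gt0 // ltr0n; lia.
  rewrite powR_mulrn // mulrAC ler_pdivrMr // mul1r F_card -cardP -natrX -natrM ler_nat.
  by apply: leq_trans Cn _; rewrite leq_mul2l leq_exp2l // leqnSn orbT.
exists (F \o A), (F \o B); split.
- by move=> i; split; [apply: F_sub|apply: F_large].
- by move=> i; split; [apply: F_sub|apply: F_large].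
move=> a b aA bB.
have /fin_all_exists2[a' a'A aE] : forall i, exists2 i', i' \in A i & a i = val i'.
  by move=> i; have /imfsetP := aA i.
have /fin_all_exists2[b' b'B bE] : forall i, exists2 i', i' \in B i & b i = val i'.
  by move=> i; have /imfsetP := bB i.
have k0 : (0 < k)%N by lia.
have -> : a = (val \o a') by apply/funext => i; rewrite aE.
have -> : b = (val \o b') by apply/funext => i; rewrite bE.
split; apply: (avoids_range (Ordinal k0)) => s j j' s_inj.
  by have [] := AB a' b' a'A b'B s j j' s_inj.
by have [] := AB a' b' a'A b'B s j j' s_inj.
Qed.
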